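(* Let $C$ be a nonempty closed convex subset of a real Hilbert space $\mathbb{H}$, let $f : C \times C \to \mathbb{R}$ satisfy $f(x,x)=0$ for all $x\in C$, and let $T : C \to C$. Assume: (A1) $f$ is jointly weakly continuous on $C \times C$; (A2) for every $x \in C$, $f(x,\cdot)$ is convex, lower semicontinuous and subdifferentiable on $C$; (A3) $f$ is pseudomonotone on $C$ with respect to $Sol(C,f)$, i.e. $f(x,x^* ) \le 0$ for all $x \in C$ and $x^* \in Sol(C,f)$; (A4) there are constants $L_1>0$, $L_2>0$ such that $f(x,y)+f(y,z) \ge f(x,z) - L_1\|x-y\|^2 - L_2\|y-z\|^2$ for all $x,y,z \in C$; (A5) $T$ is an $(\alpha,\beta,\gamma,\delta)$-symmetric generalized hybrid mapping with $\alpha+2\beta+\gamma \ge 0$, $\alpha+\beta>0$, $\delta \ge 0$, and $Fix(T)\neq\emptyset$. Suppose that $S = Sol(C,f) \cap Fix(T)$ is nonempty. Let $\{x^k\}$, $\{y^k\}$, $\{z^k\}$ be the sequences generated, from a starting point $x^0 = x^g \in C$, by Algorithm 1 (described in the context, with parameters as stated there). Then $\{x^k\}$, $\{y^k\}$ and $\{z^k\}$ all converge strongly to $x^* = P_S(x^g)$.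
   Context: Notation. $\langle\cdot,\cdot\rangle$ and $\|\cdot\|$ are the inner product and norm of $\mathbb{H}$. $Sol(C,f) = \{x^* \in C : f(x^*,y)\ge 0 \ \forall y \in C\}$ is the solution set of the equilibrium problem. $Fix(T)=\{x\in C: Tx=x\}$. $P_D$ denotes the metric projection onto a nonempty closed convex set $D$. Joint weak continuity: $f$ is jointly weakly continuous on $C\times C$ if whenever $x,y\in C$ and $\{x^k\},\{y^k\}\subset C$ converge weakly to $x$ and $y$ respectively, then $f(x^k,y^k)\to f(x,y)$. Subdifferentiability: for $z,x\in C$, $\partial_2 f(z,x) = \{w\in\mathbb{H} : f(z,y)\ge f(z,x)+\langle w,y-x\rangle \ \forall y\in C\}$; $f(z,\cdot)$ is subdifferentiable on $C$ if $\partial_2 f(z,x)\ne\emptyset$ for all $x\in C$. Symmetric generalized hybrid mapping: $T$ is $(\alpha,\beta,\gamma,\delta)$-symmetric generalized hybrid, where $\alpha,\beta,\gamma,\delta\in\mathbb{R}$, if for all $x,y\in C$, $$\alpha\|Tx-Ty\|^2+\beta\big(\|x-Ty\|^2+\|y-Tx\|^2\big)+\gamma\|x-y\|^2+\delta\big(\|x-Tx\|^2+\|y-Ty\|^2\big)\le 0.$$ Algorithm 1. Parameters: $\{\rho_k\}\subset[\underline{\rho},\bar\rho]$ with $0<\underline\rho\le\bar\rho<\min\{\frac{1}{2L_1},\frac{1}{2L_2}\}$; $\{\alpha_k\}\subset[0,1]$ with $\lim_{k\to\infty}\alpha_k=1$; $\{\beta_k\}\subset[0,\bar\beta]\subset[0,1)$.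 Start with $x^0=x^g\in C$. For $k=0,1,2,\dots$, given $x^k$: Step 1. Let $$y^k=\arg\min\{\rho_k f(x^k,y)+\tfrac12\|y-x^k\|^2 : y\in C\},\qquad z^k=\arg\min\{\rho_k f(y^k,y)+\tfrac12\|y-x^k\|^2 : y\in C\}$$ (the unique solutions of these strongly convex programs). Step 2. Compute $t^k=\alpha_k x^k+(1-\alpha_k)Tx^k$ and $u^k=\beta_k t^k+(1-\beta_k)Tz^k$. Step 3. Let $C_k=\{x\in\mathbb{H}:\|x-u^k\|\le\|x-x^k\|\}$, $Q_k=\{x\in\mathbb{H}:\langle x-x^k,x^g-x^k\rangle\le0\}$, $A_k=C_k\cap Q_k\cap C$, and set $x^{k+1}=P_{A_k}(x^g)$. *)

(* Defs.v *)
From HB Require Import structures.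
From mathcomp Require Export all_boot all_order all_algebra.
From mathcomp Require Export all_classical all_reals all_analysis.

Set Implicit Arguments.
Unset Strict Implicit.
Unset Printing Implicit Defensive.

Import Order.TTheory GRing.Theory Num.Theory.
Import numFieldNormedType.Exports.

Local Open Scope classical_set_scope.
Local Open Scope ring_scope.

(* A real Hilbert space is a complete normed space H together with a real
   inner product [ip] inducing its norm. Functions given only on a subset C of
   H are represented by total functions on H of which only the values on C are
   ever constrained or used. *)
Definition induces_norm (R : realType) (H : completeNormedModType R)
    (ip : {dot H for @idfun R}) : Prop :=
  forall v, ip v v = `|v| ^+ 2.

Section Hilbert.
Context {R : realType} {H : completeNormedModType R}.
Variable ip : {dot H for @idfun R}.
Implicit Types (C D : set H) (f : H -> H -> R) (T : H -> H).

Definition weak_cvg (x : nat -> H) (l : H) : Prop :=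
  forall w, (fun k => ip (x k) w) @ \oo --> ip l w.

(* [xget 0] picks an element of the set of minimizers, and returns the junk
   value 0 when there is none. *)
Definition argmin D (phi : H -> R) : H :=
  xget 0 [set y | D y /\ forall v, D v -> phi y <= phi v].

Definition metric_proj D (v : H) : H := argmin D (fun y => `|v - y|).

Definition Sol C f : set H := [set p | C p /\ forall y, C y -> 0 <= f p y].

Definition Fix C T : set H := [set p | C p /\ T p = p].

Definition jointly_weakly_continuous C f : Prop :=
  forall (x y : H) (xs ys : nat -> H), C x -> C y ->
    (forall k, C (xs k)) -> (forall k, C (ys k)) ->
    weak_cvg xs x -> weak_cvg ys y ->
    (fun k => f (xs k) (ys k)) @ \oo --> f x y.

(* The type [subspace C] carries the topology induced on C (points outside C
   being isolated), so this is lower semicontinuity relative to C. *)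
Definition lower_semicontinuous_on C (phi : H -> R) : Prop :=
  lower_semicontinuous (fun y : subspace C => (phi y)%:E).

Definition subdiff2 C f (z x : H) : set H :=
  [set w | forall y, C y -> f z y >= f z x + ip w (y - x)].

Definition subdifferentiable_on C f (z : H) : Prop :=
  forall x, C x -> subdiff2 C f z x !=set0.

Definition pseudomonotone_wrt_Sol C f : Prop :=
  forall x p, C x -> Sol C f p -> f x p <= 0.

Definition Lipschitz_type C f (L1 L2 : R) : Prop :=
  forall x y z, C x -> C y -> C z ->
    f x y + f y z >= f x z - L1 * `|x - y| ^+ 2 - L2 * `|y - z| ^+ 2.

Definition symmetric_generalized_hybrid C T (a b c d : R) : Prop :=
  forall x y, C x -> C y ->
    a * `|T x - T y| ^+ 2
    + b * (`|x - T y| ^+ 2 + `|y - T x| ^+ 2)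
    + c * `|x - y| ^+ 2
    + d * (`|x - T x| ^+ 2 + `|y - T y| ^+ 2) <= 0.

Definition cut_C (uk xk : H) : set H := [set v | `|v - uk| <= `|v - xk|].

Definition cut_Q (xg xk : H) : set H := [set v | ip (v - xk) (xg - xk) <= 0].

Record generated_by_algorithm C f T (rho alph bet : nat -> R)
    (xg : H) (x y z t u : nat -> H) : Prop := GeneratedByAlgorithm {
  alg_start : x 0%N = xg;
  alg_y : forall k, y k =
    argmin C (fun v => rho k * f (x k) v + 2^-1 * `|v - x k| ^+ 2);
  alg_z : forall k, z k =
    argmin C (fun v => rho k * f (y k) v + 2^-1 * `|v - x k| ^+ 2);
  alg_t : forall k, t k = alph k *: x k + (1 - alph k) *: T (x k);
  alg_u : forall k, u k = bet k *: t k + (1 - bet k) *: T (z k);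
  alg_next : forall k, x k.+1 =
    metric_proj (cut_C (u k) (x k) `&` cut_Q xg (x k) `&` C) xg }.

End Hilbert.

(* Main.v *)
Require Import Defs.
From HB Require Import structures.
From mathcomp Require Import all_boot all_order all_algebra.
From mathcomp Require Import all_classical all_reals all_analysis.
From mathcomp Require Import ring lra.
Import Order.TTheory GRing.Theory Num.Theory.
Import numFieldNormedType.Exports.
Local Open Scope classical_set_scope.
Local Open Scope ring_scope.

(* The variational inequalities of the two proximal steps and the Lipschitz-type
   condition give, for p in S,
     |z - p|^2 <= |x - p|^2 - (1 - 2 rho L1) |x - y|^2 - (1 - 2 rho L2) |y - z|^2,
   and T is quasi-nonexpansive, so |u - p| <= |x - p|: thus S stays inside every
   C_k, and by induction inside every Q_k.  Since x^k is the projection of xg onto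
   Q_k, |x^k - xg|^2 increases, to a limit delta, and successive differences of x^k
   vanish; hence so do x^k - y^k, y^k - z^k and T z^k - z^k.  A weak limit l of a
   subsequence of x^k then lies in Sol (joint weak continuity) and in Fix
   (demiclosedness), so |xg - xstar|^2 <= |xg - l|^2 <= delta.  As xstar is in Q_k,
   |xstar - x^k|^2 <= |xstar - xg|^2 - |x^k - xg|^2 <= delta - |x^k - xg|^2 -> 0.
   Monotonicity of |x^k - xg| is what makes a single subsequence suffice, without
   convexity or closedness of S. *)

(** * Inner product calculus and the Cauchy-Schwarz inequality *)

Section InnerProduct.
Context {R : realType} {H : completeNormedModType R} {ip : {dot H for @idfun R}}.
Implicit Types (u v w : H) (D : set H).

Lemma ipC u v : ip u v = ip v u.
Proof. by rewrite hermC /= expr0 mul1r. Qed.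

Lemma ipDl u v w : ip (u + v) w = ip u w + ip v w.
Proof. exact: linearDl. Qed.

Lemma ipDr u v w : ip w (u + v) = ip w u + ip w v.
Proof. exact: linearDr. Qed.

Lemma ipNl u v : ip (- u) v = - ip u v.
Proof. exact: linearNl. Qed.

Lemma ipNr u v : ip u (- v) = - ip u v.
Proof. exact: linearNr. Qed.

Lemma ip0l u : ip 0 u = 0.
Proof. exact: linear0l. Qed.

Lemma ip0r u : ip u 0 = 0.
Proof. exact: linear0r. Qed.

Lemma ipZl k u v : ip (k *: u) v = k * ip u v.
Proof. by rewrite linearZl_LR. Qed.

Lemma ipZr k u v : ip u (k *: v) = k * ip u v.
Proof. by rewrite linearZr_LR. Qed.

Definition ipE := (ipDl, ipDr, ipNl, ipNr, ipZl, ipZr).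

Hypothesis ip_norm : induces_norm ip.

Lemma normD_sqr u v : `|u + v| ^+ 2 = `|u| ^+ 2 + 2 * ip u v + `|v| ^+ 2.
Proof. by rewrite -!ip_norm !ipE (ipC v u); ring. Qed.

Lemma normB_sqr u v : `|u - v| ^+ 2 = `|u| ^+ 2 - 2 * ip u v + `|v| ^+ 2.
Proof. by rewrite -!ip_norm !ipE (ipC v u); ring. Qed.

Lemma ip_le u v : ip u v <= `|u| * `|v|.
Proof.
have [->|v0] := eqVneq v 0.
  by rewrite normr0 mulr0 ip0r.
have v1 : 0 < `|v| by rewrite normr_gt0.
(* This square expands to [2 * |u| * |v| * (|u| * |v| - ip u v)], so Cauchy-Schwarz follows after
   division by [|u| * |v|]. *)
have : 0 <= `| `|v| *: u - `|u| *: v| ^+ 2 by exact: sqr_ge0.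
rewrite normB_sqr !ipE !normrZ !normr_id => h.
have [u0|u0] := eqVneq u 0.
  by rewrite u0 normr0 mul0r ip0l.
have u1 : 0 < `|u| by rewrite normr_gt0.
rewrite -(ler_pM2l (mulr_gt0 u1 v1)).
nra.
Qed.

Lemma ip_norm_le u v : `|ip u v| <= `|u| * `|v|.
Proof.
rewrite ler_norml ip_le andbT lerNl -ipNl -[`|u|]normrN.
exact: ip_le.
Qed.

Lemma ip_cvg0 (u v : nat -> H) (M : R) : u @ \oo --> (0:H) -> (forall k, `|v k| <= M) ->
  (fun k => ip (u k) (v k)) @ \oo --> (0:R).
Proof.
move=> /cvg_norm; rewrite normr0 => u0 vM; apply/norm_cvg0P.
apply: (@squeeze_cvgr _ _ _ _ (fun=> 0) (fun k => `|u k| * M)).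
- near=> k; rewrite normr_ge0/=.
  by apply: (le_trans (ip_norm_le _ _)); rewrite ler_wpM2l.
- exact: cvg_cst.
- rewrite -[X in _ --> X](mul0r M); apply: cvgM => //; exact: cvg_cst.
Unshelve. all: end_near. Qed.

Lemma convex_setE D : convex_set D ->
  forall u v (t : R), D u -> D v -> 0 <= t <= 1 -> D (t *: u + (1 - t) *: v).
Proof.
move=> cD u v t Du Dv t01.
have := cD u v (Itv01 (andP t01).1 (andP t01).2) (mem_set Du) (mem_set Dv).
by move/set_mem.
Qed.

Lemma convex_functionE D (g : H -> R) : convex_function D g ->
  forall u v (t : R), D u -> D v -> 0 <= t <= 1 ->
  g (t *: u + (1 - t) *: v) <= t * g u + (1 - t) * g v.
Proof.
move=> cg u v t Du Dv t01.
exact: (cg (Itv01 (andP t01).1 (andP t01).2) u v (mem_set Du) (mem_set Dv)).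
Qed.

End InnerProduct.

(** * Existence and optimality condition of proximal points *)

Section Proximal.
Context {R : realType} {H : completeNormedModType R} {ip : {dot H for @idfun R}}.
Implicit Types (u v w p : H) (D : set H) (g : H -> R).
Hypothesis ip_norm : induces_norm ip.

Lemma lower_semicontinuous_onP D g : lower_semicontinuous_on D g ->
  forall v (e : R), D v -> 0 < e -> \forall w \near v, D w -> g v - e < g w.
Proof.
move=> lg v e Dv e0.
have [|V nV gV] := lg v (g v - e); first by rewrite lte_fin; lra.
have [W nW VW] := (@nbhs_subspace_ex H D V v Dv).1 nV.
apply: filterS nW => w Ww Dw; rewrite -lte_fin; apply: gV.
by have [] : (V `&` D) w by rewrite VW.
Qed.

(** The quadratic term makes the objective strongly convex, so every minimizing sequence is Cauchy,
    and lower semicontinuity passes to its limit. Besides the proximal steps, the lemma serves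
    projections ([g] zero) and the Riesz theorem ([g] linear). *)
Lemma prox_exists D g x : closed D -> D !=set0 ->
  (forall u v (t : R), D u -> D v -> 0 <= t <= 1 -> D (t *: u + (1 - t) *: v)) ->
  (forall u v (t : R), D u -> D v -> 0 <= t <= 1 ->
    g (t *: u + (1 - t) *: v) <= t * g u + (1 - t) * g v) ->
  (forall v (e : R), D v -> 0 < e -> \forall w \near v, D w -> g v - e < g w) ->
  (exists K c : R, 0 <= K /\ forall v, D v -> c - K * `|v| <= g v) ->
  exists y, D y /\ forall v, D v ->
    g y + 2^-1 * `|y - x| ^+ 2 <= g v + 2^-1 * `|v - x| ^+ 2.
Proof.
move=> clD [v0 Dv0] cD cg lg [K [c [K0 Kc]]].
pose phi v := g v + 2^-1 * `|v - x| ^+ 2.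
(* Completing the square: [2^-1 * (|v - x| - K) ^+ 2 >= 0] absorbs the linear growth
   [K * |v - x|]. *)
have phi_ge v : D v -> c - K * `|x| - 2^-1 * K ^+ 2 <= phi v.
  move=> Dv; have := Kc v Dv; rewrite /phi => h.
  have : K * `|v| <= K * (`|v - x| + `|x|).
    by rewrite ler_wpM2l // -[X in `|X|](subrK x) ler_normD.
  have := sqr_ge0 (`|v - x| - K); nra.
pose m := inf (phi @` D).
have hlb : has_lbound (phi @` D).
  by exists (c - K * `|x| - 2^-1 * K ^+ 2) => _ [v Dv <-]; exact: phi_ge.
have hinf : has_inf (phi @` D) by split=> //; exists (phi v0); exists v0.
have m_le v : D v -> m <= phi v by move=> Dv; apply: ge_inf => //; exists v.
have [s sP] : {s : nat -> H & forall n, D (s n) /\ phi (s n) < m + n.+1%:R^-1}.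
  apply: (@choice nat H (fun n v => D v /\ phi v < m + n.+1%:R^-1)) => n.
  have n0 : 0 < n.+1%:R^-1 :> R by rewrite invr_gt0 ltr0Sn.
  by have [_ [v Dv <-] h] := inf_adherent n0 hinf; exists v.
(* At the midpoint of [u] and [v] the objective is at least [m], yet lies [|u - v| ^+ 2 / 8] or more
   below the average of [phi u] and [phi v]. *)
have mid u v : D u -> D v -> `|u - v| ^+ 2 <= 4 * (phi u + phi v - 2 * m).
  move=> Du Dv; have t01 : 0 <= (2^-1 : R) <= 1 by apply/andP; split; lra.
  have := m_le _ (cD u v 2^-1 Du Dv t01); have := cg u v 2^-1 Du Dv t01.
  rewrite /phi -!ip_norm !ipE (ipC v u) (ipC x u) (ipC x v); lra.
have s_cvg : cvg (s @ \oo).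
  apply/cauchy_cvgP/cauchy_exP => e e0.
  (* Two values within [e ^+ 2 / 8] of [m] make the right-hand side of [mid] less than
     [4 * (2 * (e ^+ 2 / 8)) = e ^+ 2]. *)
  have e8 : 0 < e ^+ 2 / 8 by rewrite divr_gt0 // exprn_gt0.
  have [N _ hN] := near_infty_natSinv_lt (PosNum e8).
  exists (s N); exists N => // n Nn; rewrite /= -ball_normE /=.
  rewrite -(@ltr_pXn2r _ 2) // ?nnegrE //; last exact: ltW.
  have h1 : N.+1%:R^-1 < e ^+ 2 / 8 := hN N (leqnn N).
  have h2 : n.+1%:R^-1 < e ^+ 2 / 8 := hN n Nn.
  apply: (le_lt_trans (mid _ _ (sP N).1 (sP n).1)).
  have -> : e ^+ 2 = 8 * (e ^+ 2 / 8) :> R by field.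
  move: (sP N).2 (sP n).2 h1 h2.
  move: (phi (s N)) (phi (s n)) (N.+1%:R^-1) (n.+1%:R^-1) (e ^+ 2 / 8) => a b c' d f; lra.
pose y := lim (s @ \oo); have sy : s @ \oo --> y by [].
have Dy : D y.
  by apply: (closed_cvg D clD _ _ sy); apply: nearW => n; have [] := sP n.
exists y; split=> // v Dv; apply: le_trans (m_le v Dv).
rewrite -/(phi y); apply/ler_addgt0Pr => e e0.
(* One third each for the gap to the infimum, the semicontinuity of [g], and the continuity of the
   quadratic term. *)
have e3 : 0 < e / 3 by lra.
have c1 : (fun n => 2^-1 * (`|s n - x| * `|s n - x|)) @ \oo --> 2^-1 * `|y - x| ^+ 2.
  rewrite !expr2; apply: cvgM; first exact: cvg_cst.
  by apply: cvgM; apply: cvg_norm; apply: cvgB => //; exact: cvg_cst.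
near \oo => n.
have [Dsn h1] := sP n.
have h2 : n.+1%:R^-1 < e / 3.
  by near: n; exact: (near_infty_natSinv_lt (PosNum e3)).
have h3 : g y - e / 3 < g (s n).
  by move: Dsn; near: n; exact: (sy _ (lg y _ Dy e3)).
have h4 : `|2^-1 * `|y - x| ^+ 2 - 2^-1 * `|s n - x| ^+ 2| < e / 3.
  by rewrite (expr2 `|s n - x|); near: n; exact: (cvgr_dist_lt _ _ c1).
move: h4 h1; rewrite /phi ltr_norml => /andP[h4 h5].
move: (n.+1%:R^-1) h2 => a h2; lra.
Unshelve. all: end_near. Qed.

(** First-order optimality: compare [y] with [t *: v + (1 - t) *: y], divide by [t], and let [t]
    tend to 0. *)
Lemma prox_ineq {D g x y} :
  (forall u v (t : R), D u -> D v -> 0 <= t <= 1 -> D (t *: u + (1 - t) *: v)) ->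
  (forall u v (t : R), D u -> D v -> 0 <= t <= 1 ->
    g (t *: u + (1 - t) *: v) <= t * g u + (1 - t) * g v) ->
  D y -> (forall v, D v ->
    g y + 2^-1 * `|y - x| ^+ 2 <= g v + 2^-1 * `|v - x| ^+ 2) ->
  forall v, D v -> ip (x - y) (v - y) <= g v - g y.
Proof.
move=> cD cg Dy miny v Dv; rewrite -subr_ge0; set A : R := (X in 0 <= X).
have key (t : R) : 0 < t -> t <= 1 -> 0 <= A + 2^-1 * t * `|v - y| ^+ 2.
  move=> t0 t1; have t01 : 0 <= t <= 1 by rewrite ltW.
  have := miny _ (cD v y t Dv Dy t01); have := cg v y t Dv Dy t01.
  rewrite -(pmulr_rge0 _ t0) /A.
  have -> : `|t *: v + (1 - t) *: y - x| ^+ 2 =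
      `|y - x| ^+ 2 + 2 * t * ip (y - x) (v - y) + t ^+ 2 * `|v - y| ^+ 2.
    by rewrite -!ip_norm !ipE (ipC y v) (ipC x v) (ipC y x); ring.
  have -> : ip (x - y) (v - y) = - ip (y - x) (v - y) by rewrite -ipNl opprB.
  nra.
apply/ler_addgt0Pr => e e0; rewrite addrC.
pose K := `|v - y| ^+ 2; have K0 : 0 <= K by exact: sqr_ge0.
(* This [t] keeps the remainder [2^-1 * t * K] below [e]; the [+ 1] covers [K = 0]. *)
pose t := Num.min 1 (e / (K + 1)).
have ek : 0 < e / (K + 1) by rewrite divr_gt0 //; lra.
have t0 : 0 < t by rewrite lt_min ltr01.
have t1 : t <= 1 by rewrite ge_min lexx.
have tK : t * (K + 1) <= e by rewrite -ler_pdivlMr ?ge_min ?lexx ?orbT //; lra.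
have := key t t0 t1; rewrite -/K; nra.
Qed.
End Proximal.

(** * Riesz representation and weak compactness of bounded sequences *)

Section WeakCompactness.
Context {R : realType} {H : completeNormedModType R} {ip : {dot H for @idfun R}}.
Implicit Types (u v w p : H) (D : set H).
Hypothesis ip_norm : induces_norm ip.

(** The image of [U] has a cluster point in the compact segment from [- M] to [M], and an
    ultrafilter converges to each of its cluster points. *)
Lemma ultra_bounded_cvg (I : Type) (U : set_system I) (FU : UltraFilter U)
    (h : I -> R) (M : R) :
  (forall i, `|h i| <= M) -> exists l : R, h @ U --> l.
Proof.
move=> hM.
have [|l [_ hl]] := @segment_compact R (- M) M (h @ U) (fmap_proper_filter h ultra_proper).
  by rewrite /nbhs /= /fmap; apply: filterS filterT => i _ /=; rewrite in_itv /= -ler_norml.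
exists l => B nB; have [//|nhB] := in_ultra_setVsetC (h @^-1` B) FU.
by have [r []] := hl (~` B) B nhB nB.
Qed.

(** The representing vector minimizes [2^-1 * |v| ^+ 2 - L v]; optimality tested at [y + v] and
    [y - v] gives the two inequalities. *)
Lemma riesz (L : H -> R) (M : R) : (forall u v, L (u + v) = L u + L v) ->
  (forall k v, L (k *: v) = k * L v) -> (forall v, `|L v| <= M * `|v|) ->
  exists y, forall v, L v = ip y v.
Proof.
move=> LD LZ LM.
have LB u v : L (u - v) = L u - L v by rewrite LD -scaleN1r LZ mulN1r.
(* A negative [M] is possible only in the trivial space. *)
have M0 : 0 <= M \/ forall v, v = 0.
  have [M0|M0] := leP 0 M; [by left|right=> v].
  apply/eqP; rewrite -normr_le0; have := le_trans (normr_ge0 _) (LM v).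
  by rewrite nmulr_rge0.
case: M0 => [M0|triv]; last first.
  exists 0 => v; rewrite (triv v) ip0r.
  by apply/eqP; rewrite -normr_le0 (le_trans (LM 0)) // normr0 mulr0.
have cT u v (t : R) : setT u -> setT v -> 0 <= t <= 1 ->
  [set: H] (t *: u + (1 - t) *: v) by [].
have cL u v (t : R) : setT u -> setT v -> 0 <= t <= 1 ->
    - L (t *: u + (1 - t) *: v) <= t * (- L u) + (1 - t) * (- L v).
  by move=> _ _ _; rewrite LD !LZ !mulrN -opprD.
have [] := @prox_exists R H ip ip_norm setT (fun v => - L v) 0 closedT _ cT cL.
- by exists 0.
- move=> v e _ e0; near=> w => _.
  have h : `|L (w - v)| < e.
    apply: (le_lt_trans (LM _)); apply: (@le_lt_trans _ _ ((M + 1) * `|w - v|)).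
      by rewrite ler_wpM2r // lerDl.
    rewrite mulrC -ltr_pdivlMr; last by lra.
    rewrite distrC; near: w; apply: cvgr_dist_lt; [exact: cvg_id|].
    by rewrite divr_gt0 //; lra.
  by move: h; rewrite LB ltr_norml => /andP[_]; lra.
- exists M, 0; split=> // v _; have := le_trans (ler_norm _) (LM v); lra.
- move=> y [_ miny].
  have hy := prox_ineq ip_norm cT cL I miny.
  exists y => v; have := hy (y + v) I; have := hy (y - v) I.
  rewrite LB LD !ipE !ip0l; lra.
Unshelve. all: end_near. Qed.

(** Limits along an ultrafilter define a bounded linear functional, and Riesz turns it into the
    candidate [l]; a genuine sequence of indices is extracted afterwards. The condition [n <= s n]
    stands in for strict monotonicity: it already lets limits at infinity pass to [x \o s]. *)
Lemma weak_compactness (x : nat -> H) (M : R) : (forall k, `|x k| <= M) ->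
  exists l (s : nat -> nat), (forall n, n <= s n)%N /\ weak_cvg ip (x \o s) l.
Proof.
move=> xM; have M0 : 0 <= M := le_trans (normr_ge0 _) (xM 0%N).
have [U [UU leU]] := @ultraFilterLemma nat (nbhs \oo) _.
have [L Lcvg] : {L : H -> R & forall w, (fun k => ip (x k) w) @ U --> L w}.
  apply: (@choice H R (fun w l => (fun k => ip (x k) w) @ U --> l)) => w.
  apply: (ultra_bounded_cvg _ _ UU _ (M * `|w|)) => k.
  by apply: le_trans (ip_norm_le ip_norm _ _) _; rewrite ler_wpM2r.
have Llim w r : (fun k => ip (x k) w) @ U --> r -> L w = r.
  by move=> h; exact: (cvg_unique _ (Lcvg w) h).
have [|||l lL] := @riesz L M.
- move=> u v; apply: Llim; under eq_fun do rewrite ipDr; exact: cvgD.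
- move=> k v; apply: Llim; under eq_fun do rewrite ipZr; apply: cvgM => //; exact: cvg_cst.
- move=> v; apply: (cvgr_to_le (cvg_norm (Lcvg v))); apply: nearW => k.
  by apply: le_trans (ip_norm_le ip_norm _ _) _; rewrite ler_wpM2r.
pose v k := x k - l.
have vU w : (fun k => ip (v k) w) @ U --> (0:R).
  rewrite -(subrr (L w)) {2}lL; under eq_fun do rewrite ipDl ipNl.
  by apply: cvgB => //; exact: cvg_cst.
have vM k : `|v k| <= M + `|l|.
  by rewrite (le_trans (ler_normB _ _)) // lerD2r.
(* Choosing [s n] so that the extracted [v]'s are almost orthogonal to all earlier
   terms makes them vanish weakly on the span of the sequence. *)
have [s sP] : {s : nat -> nat & forall n, (n <= s n)%N /\
    forall m : 'I_n.+1, `|ip (v (s n)) (v m)| < n.+1%:R^-1}.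
  apply: (@choice nat nat (fun n k => (n <= k)%N /\
    forall m : 'I_n.+1, `|ip (v k) (v m)| < n.+1%:R^-1)) => n.
  apply: (@filter_ex _ U); apply: filterI.
    by apply: leU; exact: nbhs_infty_ge.
  apply: filter_forall => m.
  have n0 : 0 < n.+1%:R^-1 :> R by rewrite invr_gt0 ltr0Sn.
  apply: (filterS _ (cvgr_dist_lt _ _ (vU (v m)) _ n0)) => k.
  by rewrite sub0r normrN.
exists l, s; split=> [n|]; first by have [] := sP n.
(* [E] collects the test vectors against which the extraction works; it is shown to be a closed
   subspace, and then the whole space. *)
pose E := [set w | (fun n => ip (v (s n)) w) @ \oo --> (0:R)].
have ED u w : E u -> E w -> E (u + w).
  move=> Eu Ew; rewrite /E /=; under eq_fun do rewrite ipDr.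
  by rewrite -(addr0 0); exact: cvgD.
have EZ k u : E u -> E (k *: u).
  move=> Eu; rewrite /E /=; under eq_fun do rewrite ipZr.
  by rewrite -(mulr0 k); apply: cvgM => //; exact: cvg_cst.
have Ev m : E (v m).
  apply/cvgrPdist_lt => e e0; near=> n; rewrite sub0r normrN.
  have mn : (m < n.+1)%N by rewrite ltnS; near: n; exact: nbhs_infty_ge.
  apply: (lt_trans ((sP n).2 (Ordinal mn))).
  by near: n; exact: (near_infty_natSinv_lt (PosNum e0)).
have E0 u : (forall m, ip u (v m) = 0) -> E u.
  move=> uv; rewrite /E /=.
  by under eq_fun do rewrite ipC uv; exact: cvg_cst.
have clE : closed E.
  move=> w cw; apply/cvgrPdist_lt => e e0.
  pose K := M + `|l| + 1; have K0 : 0 < K by rewrite /K ltr_wpDl // addr_ge0.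
  have eK : 0 < e / 2 / K by rewrite !divr_gt0.
  have [w' [Ew' ww']] := cw (ball w (e / 2 / K)) (nbhsx_ballx _ _ eK).
  have e2 : 0 < e / 2 by rewrite divr_gt0.
  apply: (filterS _ (cvgr_dist_lt _ _ Ew' _ e2)) => n.
  rewrite !sub0r !normrN => h.
  have -> : ip (v (s n)) w = ip (v (s n)) w' + ip (v (s n)) (w - w').
    by rewrite -ipDr addrC subrK.
  apply: (le_lt_trans (ler_normD _ _)); rewrite [ltRHS]splitr; apply: ltrD => //.
  apply: (le_lt_trans (ip_norm_le ip_norm _ _)).
  apply: (@le_lt_trans _ _ (K * `|w - w'|)).
    by rewrite ler_wpM2r // (le_trans (vM _)) // /K lerDl.
  by rewrite mulrC -ltr_pdivlMr //; move: ww'; rewrite -ball_normE.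
have cE u w (t : R) : E u -> E w -> 0 <= t <= 1 -> E (t *: u + (1 - t) *: w).
  by move=> Eu Ew _; apply: ED; exact: EZ.
have c0 u w (t : R) : E u -> E w -> 0 <= t <= 1 ->
    (0 : R) <= t * 0 + (1 - t) * 0.
  by move=> _ _ _; rewrite !mulr0 addr0.
(* Decompose [w] along [E]: its part orthogonal to [E] annihilates every
   [v m], so it lies in [E] as well. *)
have Eall w : E w.
  have [|||y [Ey miny]] := @prox_exists R H ip ip_norm E (fun=> 0) w clE _ cE c0.
  - by exists (v 0%N).
  - by move=> u e _ e0; apply: nearW => z _; rewrite sub0r oppr_lt0.
  - by exists 0, 0; split=> // u _; rewrite mul0r subr0.
  rewrite -(subrK y w); apply: (ED) => //; apply: E0 => m.
  have hy := prox_ineq ip_norm cE c0 Ey miny.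
  have := hy _ (ED _ _ Ey (Ev m)); have := hy _ (ED _ _ Ey (EZ (-1) _ (Ev m))).
  rewrite scaleN1r !(addrC y) !addrK ipNr; lra.
move=> w; have := Eall w; rewrite /E /= => Ew.
rewrite -[ip l w]add0r.
have -> : (fun k => ip ((x \o s) k) w) = (fun n => ip (v (s n)) w + ip l w).
  by apply/funext => n /=; rewrite -ipDl subrK.
by apply: cvgD => //; exact: cvg_cst.
Unshelve. all: end_near. Qed.

(** With [y] the projection of [l] onto [D], the inequality [ip (l - y) (x k - y) <= 0] passes to
    the weak limit and becomes [|l - y| ^+ 2 <= 0]. *)
Lemma weak_cvg_closed_convex D (x : nat -> H) l : closed D -> convex_set D ->
  (forall k, D (x k)) -> weak_cvg ip x l -> D l.
Proof.
move=> clD /convex_setE cD Dx xl.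
have c0 u w (t : R) : D u -> D w -> 0 <= t <= 1 ->
    (0 : R) <= t * 0 + (1 - t) * 0.
  by move=> _ _ _; rewrite !mulr0 addr0.
have [|||y [Dy miny]] := @prox_exists R H ip ip_norm D (fun=> 0) l clD _ cD c0.
- by exists (x 0%N).
- by move=> u e _ e0; apply: nearW => z _; rewrite sub0r oppr_lt0.
- by exists 0, 0; split=> // u _; rewrite mul0r subr0.
have hy := prox_ineq ip_norm cD c0 Dy miny.
suff : ip (l - y) (l - y) <= 0.
  by rewrite ip_norm exprn_even_le0 //= normr_eq0 subr_eq0 => /eqP ->.
have : (fun k => ip (x k) (l - y) - ip y (l - y)) @ \oo --> ip (l - y) (l - y).
  by rewrite [in X in _ --> X]ipDl ipNl; apply: cvgB; [exact: xl|exact: cvg_cst].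
move=> h; apply: (cvgr_to_le h); apply: nearW => k.
by rewrite -ipNl -ipDl ipC (le_trans (hy _ (Dx k))) // subrr.
Qed.

End WeakCompactness.

(** * Sequences tending to zero and subsequences *)

Section NullSequences.
Context {R : realType} {H : completeNormedModType R}.

Lemma cvg0_le (h : nat -> H) (e : nat -> R) :
  (forall k, `|h k| <= e k) -> e @ \oo --> (0 : R) -> h @ \oo --> (0 : H).
Proof.
move=> he e0; apply/norm_cvg0P.
apply: (@squeeze_cvgr _ _ _ _ (fun=> 0) e) => //; last exact: cvg_cst.
by apply: nearW => k; rewrite normr_ge0 he.
Qed.

Lemma cvg0_sqr_le (h : nat -> H) (e : nat -> R) :
  (forall k, `|h k| ^+ 2 <= e k) -> e @ \oo --> (0 : R) -> h @ \oo --> (0 : H).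
Proof.
move=> he e0; apply/cvgrPdist_lt => r r0.
have r2 : 0 < r ^+ 2 by rewrite exprn_gt0.
apply: (filterS _ (cvgr_dist_lt _ _ e0 _ r2)) => k.
rewrite !sub0r !normrN => ek.
rewrite -(@ltr_pXn2r _ 2) // ?nnegrE //; last exact: ltW.
by apply: le_lt_trans (he k) (le_lt_trans (ler_norm _) ek).
Qed.

Lemma cvg_subseq (T : topologicalType) (h : nat -> T) (s : nat -> nat) (l : T) :
  (forall n, n <= s n)%N -> h @ \oo --> l -> (h \o s) @ \oo --> l.
Proof.
move=> sn; apply: cvg_comp => B [N _ NB].
by exists N => // n /= Nn; apply: NB => /=; exact: leq_trans Nn (sn n).
Qed.

End NullSequences.

(** * Half-spaces, projections, proximal steps and weak limits *)

Section HilbertGeometry.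
Context {R : realType} {H : completeNormedModType R} {ip : {dot H for @idfun R}}.
Implicit Types (u v w p : H) (D : set H).
Hypothesis ip_norm : induces_norm ip.

Lemma halfspace_closed w (r : R) : closed [set v | ip v w <= r].
Proof.
apply: (@closed_comp _ _ (ip^~ w) [set c | c <= r]); last exact: closed_le.
move=> v _; apply/cvgrPdist_lt => e e0; near=> v'.
rewrite -ipNl -ipDl; apply: (le_lt_trans (ip_norm_le ip_norm _ _)).
apply: (@le_lt_trans _ _ (`|v - v'| * (`|w| + 1))).
  by rewrite ler_wpM2l // lerDl.
have w0 : 0 < `|w| + 1 by rewrite ltr_wpDl.
rewrite -ltr_pdivlMr //; near: v'; apply: cvgr_dist_lt; first exact: cvg_id.
exact: divr_gt0.
Unshelve. all: end_near. Qed.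

(** Squaring both distances cancels [|v| ^+ 2]. The half-space form makes closedness and convexity
    of the cuts immediate. *)
Lemma cut_CE u x : cut_C u x = [set v | ip v (x - u) <= 2^-1 * (`|x| ^+ 2 - `|u| ^+ 2)].
Proof.
rewrite /cut_C; apply/funext => v /=.
rewrite -[`|v - u| <= _](@ler_pXn2r _ 2) ?nnegrE // !(normB_sqr ip_norm) !ipE.
by apply/propext; split; lra.
Qed.

Lemma cut_QE xg x : cut_Q ip xg x = [set v | ip v (xg - x) <= ip x (xg - x)].
Proof.
by apply/seteqP; split=> v; rewrite /cut_Q /= ipDl ipNl subr_le0.
Qed.

(** Projection is the proximal step of the zero function. Existence comes first, so that [xget]
    returns a minimizer and not its default 0. *)
Lemma metric_projP D v : closed D -> D !=set0 ->
  (forall u w (t : R), D u -> D w -> 0 <= t <= 1 -> D (t *: u + (1 - t) *: w)) ->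
  D (metric_proj D v) /\
  forall w, D w -> ip (v - metric_proj D v) (w - metric_proj D v) <= 0.
Proof.
move=> clD D0 cD.
have c0 u w (t : R) : D u -> D w -> 0 <= t <= 1 ->
    (0 : R) <= t * 0 + (1 - t) * 0.
  by move=> _ _ _; rewrite !mulr0 addr0.
have [||y [Dy miny]] := @prox_exists R H ip ip_norm D (fun=> 0) v clD D0 cD c0.
- by move=> u e _ e0; apply: nearW => z _; rewrite sub0r oppr_lt0.
- by exists 0, 0; split=> // u _; rewrite mul0r subr0.
have sqrE (a b : H) : (0 + 2^-1 * `|a - v| ^+ 2 <= 0 + 2^-1 * `|b - v| ^+ 2 :> R)
    = (`|v - a| <= `|v - b|).
  by rewrite !add0r ler_pM2l // ler_pXn2r ?nnegrE // !(distrC v).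
have ey : exists y, D y /\ forall w, D w -> `|v - y| <= `|v - w|.
  by exists y; split=> // w /miny; rewrite sqrE.
have [DP minP] : D (metric_proj D v) /\
    forall w, D w -> `|v - metric_proj D v| <= `|v - w|.
  exact: (xgetPex 0 ey).
split=> // w Dw; rewrite -[leRHS](subrr 0).
apply: (prox_ineq ip_norm cD c0 DP) => // w' Dw'.
by rewrite sqrE; exact: minP.
Qed.

(** A single affine minorant of [g], combined with Cauchy-Schwarz, supplies the growth bound that
    [prox_exists] asks for. *)
Lemma argmin_prox D (g : H -> R) x (r : R) : closed D -> convex_set D ->
  convex_function D g -> lower_semicontinuous_on D g ->
  (exists q w, D q /\ forall v, D v -> g q + ip w (v - q) <= g v) -> 0 < r ->
  let y := argmin D (fun v => r * g v + 2^-1 * `|v - x| ^+ 2) in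
  D y /\ forall v, D v -> ip (x - y) (v - y) <= r * (g v - g y).
Proof.
move=> clD /convex_setE cD /convex_functionE cg lg [q [w [Dq wg]]] r0 y.
have crg u v (t : R) : D u -> D v -> 0 <= t <= 1 ->
    r * g (t *: u + (1 - t) *: v) <= t * (r * g u) + (1 - t) * (r * g v).
  move=> Du Dv t01; have := cg u v t Du Dv t01; rewrite -(ler_pM2l r0); lra.
have ey : exists y, D y /\ forall v, D v ->
    r * g y + 2^-1 * `|y - x| ^+ 2 <= r * g v + 2^-1 * `|v - x| ^+ 2.
  apply: (prox_exists ip_norm) => //; first by exists q.
  - move=> v e Dv e0; have er : 0 < e / r by rewrite divr_gt0.
    apply: filterS (lower_semicontinuous_onP D g lg v (e / r) Dv er) => v' gv' Dv'.
    have := gv' Dv'; rewrite -(ltr_pM2l r0) mulrBr; congr (_ - _ < _).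
    by rewrite mulrC divfK // gt_eqF.
  - exists (r * `|w|), (r * (g q - ip w q)); split=> [|v Dv].
      by rewrite mulr_ge0 // ltW.
    rewrite -mulrA -mulrBr ler_pM2l //; have := wg v Dv; rewrite !ipE.
    by have := ip_le ip_norm (- w) v; rewrite ipNl normrN; lra.
have [Dy miny] := xgetPex 0 ey.
split=> // v Dv; rewrite mulrBr.
exact: (prox_ineq (g := fun v => r * g v) ip_norm cD crg Dy miny).
Qed.

Lemma weak_cvg_add (x e : nat -> H) l : weak_cvg ip x l -> e @ \oo --> (0 : H) ->
  weak_cvg ip (fun k => x k + e k) l.
Proof.
move=> xl e0 w; under eq_fun do rewrite ipDl.
rewrite -[ip l w]addr0; apply: cvgD; first exact: xl.
exact: (ip_cvg0 ip_norm _ (fun=> w) `|w|).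
Qed.

(** Test the weak convergence against [l - v], apply Cauchy-Schwarz, and divide by [|l - v|]. *)
Lemma weak_cvg_norm_le (x : nat -> H) l v (M : R) : weak_cvg ip x l ->
  (forall k, `|x k - v| <= M) -> `|l - v| <= M.
Proof.
move=> xl xM; have M0 : 0 <= M := le_trans (normr_ge0 _) (xM 0%N).
have [->|lv] := eqVneq l v; first by rewrite subrr normr0.
have lv0 : 0 < `|l - v| by rewrite normr_gt0 subr_eq0.
rewrite -(ler_pM2r lv0) -expr2 -ip_norm.
have h : (fun k => ip (x k) (l - v) - ip v (l - v)) @ \oo --> ip (l - v) (l - v).
  by rewrite [in X in _ --> X]ipDl ipNl; apply: cvgB; [exact: xl|exact: cvg_cst].
apply: (cvgr_to_le h); apply: nearW => k.
rewrite -ipNl -ipDl; apply: (le_trans (ip_le ip_norm _ _)).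
by rewrite ler_pM2r.
Qed.

End HilbertGeometry.

(** * Symmetric generalized hybrid mappings *)

Section Hybrid.
Context {R : realType} {H : completeNormedModType R} {ip : {dot H for @idfun R}}.
Hypothesis ip_norm : induces_norm ip.
Context {C : set H} {T : H -> H} {a b c d : R}.
Hypothesis hybrid : symmetric_generalized_hybrid C T a b c d.
Hypotheses (abc_ge0 : 0 <= a + 2 * b + c) (ab_gt0 : 0 < a + b) (d_ge0 : 0 <= d).

(** At a fixed point the hybrid inequality bounds [(a + b) * |T x - p| ^+ 2] by
    [- (b + c) * |x - p| ^+ 2], and [- (b + c) <= a + b]. *)
Lemma hybrid_quasi_nonexpansive x p : C x -> Fix C T p -> `|T x - p| <= `|x - p|.
Proof.
move=> Cx [Cp Tp]; have := hybrid x p Cx Cp.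
rewrite Tp subrr normr0 expr0n addr0 (distrC p).
rewrite -[`|T x - p| <= _](@ler_pXn2r _ 2) ?nnegrE //.
have := sqr_ge0 `|T x - p|; have := sqr_ge0 `|x - p|; have := sqr_ge0 `|x - T x|.
move: (`|T x - p| ^+ 2) (`|x - p| ^+ 2) (`|x - T x| ^+ 2) => A B E E0 B0 A0 h.
have hd : 0 <= d * E by exact: mulr_ge0.
have hB : 0 <= (a + 2 * b + c) * B by exact: mulr_ge0.
rewrite -(ler_pM2l ab_gt0). lra.
Qed.

Lemma hybrid_demiclosed (z : nat -> H) l (M : R) : (forall k, C (z k)) -> C l ->
  (forall k, `|z k| <= M) -> weak_cvg ip z l ->
  (fun k => T (z k) - z k) @ \oo --> (0 : H) -> T l = l.
Proof.
move=> Cz Cl zM zl Tz.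
pose e k := T (z k) - z k; pose N k := `|e k| * `|e k|.
have N0 : N @ \oo --> (0 : R).
  have e0 : (fun k => `|e k|) @ \oo --> (0 : R).
    by rewrite -(@normr0 _ H); exact: cvg_norm.
  by rewrite -(mulr0 0); exact: cvgM.
have zB v k : `|z k - v| <= M + `|v|.
  by rewrite (le_trans (ler_normB _ _)) // lerD2r.
have c1 : (fun k => ip (e k) (z k - T l)) @ \oo --> (0 : R).
  exact: (ip_cvg0 ip_norm _ _ _ Tz (zB (T l))).
have c2 : (fun k => ip (e k) (z k - l)) @ \oo --> (0 : R).
  exact: (ip_cvg0 ip_norm _ _ _ Tz (zB l)).
have c3 : (fun k => ip (z k) (l - T l) - ip l (l - T l)) @ \oo --> (0 : R).
  by rewrite -(subrr (ip l (l - T l))); apply: cvgB; [exact: zl|exact: cvg_cst].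
(* Substituting [T (z k) = z k + e k] in the hybrid inequality at [z k] and [l] gives this
   expression plus [(a + 2 * b + c) * |z k - l| ^+ 2], a nonnegative term that is dropped. *)
have lim : (fun k => (a + b + d) * `|l - T l| ^+ 2 +
    (2 * a * ip (e k) (z k - T l) + 2 * b * ip (e k) (z k - l) +
    2 * (a + b) * (ip (z k) (l - T l) - ip l (l - T l)) + (a + b + d) * N k))
    @ \oo --> (a + b + d) * `|l - T l| ^+ 2 +
    (2 * a * 0 + 2 * b * 0 + 2 * (a + b) * 0 + (a + b + d) * 0).
  apply: cvgD; first exact: cvg_cst.
  by apply: cvgD; first (apply: cvgD; first apply: cvgD);
    (apply: cvgM; first exact: cvg_cst).
have := cvgr_to_le (b := 0) lim; rewrite !mulr0 !addr0 => fin.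
have : (a + b + d) * `|l - T l| ^+ 2 <= 0.
  apply: fin; apply: nearW => k; have := hybrid (z k) l (Cz k) Cl.
  have := mulr_ge0 abc_ge0 (sqr_ge0 `|z k - l|).
  rewrite /N -expr2 /e -!ip_norm !ipE (ipC (T (z k)) (z k)) (ipC (T l) (z k)).
  rewrite (ipC l (z k)) (ipC (T l) (T (z k))) (ipC l (T (z k))) (ipC (T l) l); lra.
have abd : 0 < a + b + d by exact: ltr_wpDr d_ge0 ab_gt0.
by rewrite pmulr_rle0 // exprn_even_le0 //= normr_eq0 subr_eq0 => /eqP.
Qed.

End Hybrid.

(** * Descent estimate for one iteration *)

Section Extragradient.
Context {R : realType} {H : completeNormedModType R} {ip : {dot H for @idfun R}}.
Hypothesis ip_norm : induces_norm ip.

(** Test the first step at [z] and the second at [p]. Adding them through the Lipschitz-type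
    condition cancels [f y z], pseudomonotonicity discards [f y p], and two cosine laws ([E1], [E2])
    turn inner products into distances. *)
Lemma extragradient_ineq {C : set H} {f : H -> H -> R} {L1 L2 r : R} {x y z p} :
  pseudomonotone_wrt_Sol C f -> Lipschitz_type C f L1 L2 -> 0 < r ->
  C x -> C y -> C z -> Sol C f p ->
  (forall v, C v -> ip (x - y) (v - y) <= r * (f x v - f x y)) ->
  (forall v, C v -> ip (x - z) (v - z) <= r * (f y v - f y z)) ->
  `|z - p| ^+ 2 <= `|x - p| ^+ 2 - (1 - 2 * r * L1) * `|x - y| ^+ 2
    - (1 - 2 * r * L2) * `|y - z| ^+ 2.
Proof.
move=> psm lip r0 Cx Cy Cz Sp hy hz.
have h1 := hy z Cz; have h2 := hz p Sp.1.
have h3 : r * f y p <= 0 by rewrite pmulr_rle0 //; exact: psm.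
have := lip x y z Cx Cy Cz; rewrite -(ler_pM2l r0) => h4.
have E1 : `|x - p| ^+ 2 = `|x - z| ^+ 2 + `|z - p| ^+ 2 - 2 * ip (x - z) (p - z).
  rewrite -!ip_norm !ipE (ipC z x) (ipC p x) (ipC z p); ring.
have E2 : `|x - z| ^+ 2 = `|x - y| ^+ 2 + `|y - z| ^+ 2 - 2 * ip (x - y) (z - y).
  rewrite -!ip_norm !ipE (ipC z x) (ipC y x) (ipC z y); ring.
rewrite E1 E2; move: h1 h2 h3 h4; rewrite !mulrBr !mulrDr; lra.
Qed.

End Extragradient.

Lemma convrB (R : pzRingType) (V : lmodType R) (u v w : V) (t : R) :
  t *: u + (1 - t) *: v - w = t *: (u - w) + (1 - t) *: (v - w).
Proof. by rewrite !scalerBr addrACA -opprD -scalerDl addrCA subrr addr0 scale1r. Qed.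

(** The two sides differ by exactly [t * (1 - t) * |u - v| ^+ 2]. *)
Lemma norm_conv_sqr_le {R : realType} {H : completeNormedModType R}
    {ip : {dot H for @idfun R}} (ip_norm : induces_norm ip) (u v p : H) (t : R) :
  0 <= t <= 1 ->
  `|t *: u + (1 - t) *: v - p| ^+ 2 <= t * `|u - p| ^+ 2 + (1 - t) * `|v - p| ^+ 2.
Proof.
move=> /andP[t0 t1]; have s0 : 0 <= 1 - t by lra.
have := mulr_ge0 (mulr_ge0 t0 s0) (sqr_ge0 `|u - v|).
rewrite -!ip_norm !ipE (ipC v u) (ipC p u) (ipC p v); lra.
Qed.

(** The point [t] is no farther from [p] than [x], while [T z] inherits the extragradient gain and
    has weight at least [1 - be_hi] in [u]. Only the bounds [r_hi] and [be_hi] appear in the gain,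
    so it is uniform over iterations. *)
Lemma hybrid_extragradient_descent {R : realType} {H : completeNormedModType R}
    {ip : {dot H for @idfun R}} (ip_norm : induces_norm ip) {C : set H}
    {f : H -> H -> R} {T : H -> H} {L1 L2 r r_hi al be be_hi : R} {x y z t u p : H} :
  pseudomonotone_wrt_Sol C f -> 0 < L1 -> 0 < L2 -> Lipschitz_type C f L1 L2 ->
  0 < r <= r_hi -> 2 * r_hi * L1 < 1 -> 2 * r_hi * L2 < 1 ->
  0 <= al <= 1 -> 0 <= be <= be_hi -> be_hi < 1 ->
  C x -> C y -> C z -> Sol C f p ->
  (forall v, C v -> `|T v - p| <= `|v - p|) ->
  (forall v, C v -> ip (x - y) (v - y) <= r * (f x v - f x y)) ->
  (forall v, C v -> ip (x - z) (v - z) <= r * (f y v - f y z)) ->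
  t = al *: x + (1 - al) *: T x -> u = be *: t + (1 - be) *: T z ->
  (1 - be_hi) * ((1 - 2 * r_hi * L1) * `|x - y| ^+ 2
    + (1 - 2 * r_hi * L2) * `|y - z| ^+ 2) <= `|x - p| ^+ 2 - `|u - p| ^+ 2.
Proof.
move=> psm L1_gt0 L2_gt0 lip /andP[r0 r1] rL1 rL2 al01 /andP[b0 b1] bhi.
move=> Cx Cy Cz Sp Tp hy hz t_def u_def.
have Tsqr v : C v -> `|T v - p| ^+ 2 <= `|v - p| ^+ 2.
  by move=> Cv; rewrite ler_pXn2r ?nnegrE //; exact: Tp.
have tp : `|t - p| ^+ 2 <= `|x - p| ^+ 2.
  rewrite t_def; apply: (le_trans (norm_conv_sqr_le ip_norm _ _ _ _ al01)).
  have s0 : 0 <= 1 - al by case/andP: al01; lra.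
  by have := ler_wpM2l s0 (Tsqr x Cx); lra.
have be01 : 0 <= be <= 1 by apply/andP; split; lra.
have := norm_conv_sqr_le ip_norm t (T z) p _ be01; rewrite -u_def.
have zp := extragradient_ineq ip_norm psm lip r0 Cx Cy Cz Sp hy hz.
move: tp zp (Tsqr z Cz) (sqr_ge0 `|x - y|) (sqr_ge0 `|y - z|).
move: (`|t - p| ^+ 2) (`|x - p| ^+ 2) (`|z - p| ^+ 2) (`|T z - p| ^+ 2)
  (`|x - y| ^+ 2) (`|y - z| ^+ 2) (`|u - p| ^+ 2).
move=> tp xp zp Tzp xy yz up h1 h2 h3 xy0 yz0 h4.
have s0 : 0 <= 1 - be by lra.
have g1 : r * (L1 * xy) <= r_hi * (L1 * xy).
  by apply: ler_wpM2r => //; rewrite mulr_ge0 // ltW.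
have g2 : r * (L2 * yz) <= r_hi * (L2 * yz).
  by apply: ler_wpM2r => //; rewrite mulr_ge0 // ltW.
set W := _ * xy + _ * yz.
have W0 : 0 <= W.
  by apply: addr_ge0; apply: mulr_ge0 => //; rewrite subr_ge0 ltW.
have zpW : Tzp <= xp - W by rewrite /W; lra.
have k1 := ler_wpM2l s0 zpW; have k2 := ler_wpM2l b0 h1.
have k3 : (1 - be_hi) * W <= (1 - be) * W by rewrite ler_wpM2r //; lra.
clearbody W; move: h4 k1 k2 k3; clear; lra.
Qed.

(** * Strong convergence of the algorithm *)

Theorem theorem1 (R : realType) (H : completeNormedModType R)
    (ip : {dot H for @idfun R}) (ip_norm : induces_norm ip)
    (C : set H) (C_nonempty : C !=set0) (C_closed : closed C)
    (C_convex : convex_set C)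
    (f : H -> H -> R) (f_diag : forall x, C x -> f x x = 0)
    (T : H -> H) (T_maps : forall x, C x -> C (T x))
    (A1 : jointly_weakly_continuous ip C f)
    (A2 : forall x, C x ->
      [/\ convex_function C (f x), lower_semicontinuous_on C (f x)
        & subdifferentiable_on ip C f x])
    (A3 : pseudomonotone_wrt_Sol C f)
    (L1 L2 : R) (L1_gt0 : 0 < L1) (L2_gt0 : 0 < L2)
    (A4 : Lipschitz_type C f L1 L2)
    (a b c d : R)
    (A5 : symmetric_generalized_hybrid C T a b c d)
    (A5_sum : 0 <= a + 2 * b + c) (A5_ab : 0 < a + b) (A5_d : 0 <= d)
    (A5_Fix : Fix C T !=set0)
    (S_nonempty : Sol C f `&` Fix C T !=set0)
    (rho_lo rho_hi : R) (rho_lo_gt0 : 0 < rho_lo) (rho_lo_hi : rho_lo <= rho_hi)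
    (rho_hi_lt : rho_hi < Num.min (1 / (2 * L1)) (1 / (2 * L2)))
    (rho : nat -> R) (rho_bounds : forall k, rho_lo <= rho k <= rho_hi)
    (alph : nat -> R) (alph_bounds : forall k, 0 <= alph k <= 1)
    (alph_cvg : alph @ \oo --> (1 : R))
    (bet_hi : R) (bet_hi_bounds : 0 <= bet_hi < 1)
    (bet : nat -> R) (bet_bounds : forall k, 0 <= bet k <= bet_hi)
    (xg : H) (xg_in : C xg) (x y z t u : nat -> H)
    (gen : generated_by_algorithm ip C f T rho alph bet xg x y z t u) :
  let xstar := metric_proj (Sol C f `&` Fix C T) xg in
  [/\ x @ \oo --> xstar, y @ \oo --> xstar & z @ \oo --> xstar].
Proof.
case: gen => x0 y_def z_def t_def u_def x_next xstar.
set S := Sol C f `&` Fix C T in S_nonempty xstar *.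
have CE := convex_setE _ C_convex.
have rho_gt0 k : 0 < rho k.
  by have /andP[h _] := rho_bounds k; exact: lt_le_trans h.
have [rho_L1 rho_L2] : 2 * rho_hi * L1 < 1 /\ 2 * rho_hi * L2 < 1.
  move: rho_hi_lt; rewrite lt_min !ltr_pdivlMr ?mulr_gt0 // => /andP[]; lra.
have bet_hi1 : 0 < 1 - bet_hi by lra.
have bet01 k : 0 <= bet k <= 1.
  have /andP[-> h] := bet_bounds k; case/andP: bet_hi_bounds => _ /ltW.
  exact: le_trans.
have prox v w k : C v -> C w ->
    let q := argmin C (fun v' => rho k * f v v' + 2^-1 * `|v' - w| ^+ 2) in
    C q /\ forall v', C v' -> ip (w - q) (v' - q) <= rho k * (f v v' - f v q).
  move=> Cv Cw; have [cf lf sf] := A2 v Cv.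
  apply: (argmin_prox ip_norm) => //.
  (* The subgradient of [f v] at the point [v] itself is the affine minorant. *)
  by have [g gP] := sf v Cv; exists v, g.
have Ty v p : C v -> S p -> `|T v - p| <= `|v - p|.
  by move=> Cv [_ Fp]; exact: (hybrid_quasi_nonexpansive A5 A5_sum A5_ab A5_d).
have yP k : C (x k) -> C (y k) /\
    forall v, C v -> ip (x k - y k) (v - y k) <= rho k * (f (x k) v - f (x k) (y k)).
  by move=> Cx; rewrite y_def; exact: prox.
have zP k : C (x k) -> C (z k) /\
    forall v, C v -> ip (x k - z k) (v - z k) <= rho k * (f (y k) v - f (y k) (z k)).
  by move=> Cx; rewrite z_def; apply: prox => //; have [] := yP k Cx.
have uP k p : C (x k) -> S p ->
    (1 - bet_hi) * ((1 - 2 * rho_hi * L1) * `|x k - y k| ^+ 2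
      + (1 - 2 * rho_hi * L2) * `|y k - z k| ^+ 2)
    <= `|x k - p| ^+ 2 - `|u k - p| ^+ 2.
  move=> Cx Sp; have [Cy hy] := yP k Cx; have [Cz hz] := zP k Cx.
  have /andP[_ r1] := rho_bounds k; have /andP[_ bhi] := bet_hi_bounds.
  apply: (hybrid_extragradient_descent ip_norm A3 L1_gt0 L2_gt0 A4 _ rho_L1 rho_L2
    (alph_bounds k) (bet_bounds k) bhi Cx Cy Cz Sp.1 _ hy hz (t_def k) (u_def k)).
    by rewrite rho_gt0.
  by move=> v Cv; exact: Ty.
have e1 : 0 < 1 - 2 * rho_hi * L1 by lra.
have e2 : 0 < 1 - 2 * rho_hi * L2 by lra.
have up k p : C (x k) -> S p -> `|u k - p| <= `|x k - p|.
  move=> Cx Sp; rewrite -(@ler_pXn2r _ 2) ?nnegrE // -subr_ge0.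
  apply: le_trans (uP k p Cx Sp); apply: mulr_ge0; first exact: ltW.
  by apply: addr_ge0; apply: mulr_ge0; rewrite ?sqr_ge0 // ltW.
pose A k := cut_C (u k) (x k) `&` cut_Q ip xg (x k) `&` C.
have A_proj k : A k !=set0 -> A k (x k.+1) /\
    forall w, A k w -> ip (xg - x k.+1) (w - x k.+1) <= 0.
  move=> A0; rewrite x_next -/(A k); apply: (metric_projP ip_norm) => //.
    rewrite /A (cut_CE ip_norm) cut_QE.
    by apply: closedI => //; apply: closedI; exact: (halfspace_closed ip_norm).
  move=> v w r; rewrite /A (cut_CE ip_norm) cut_QE /= => -[[v1 v2] v3] [[w1 w2] w3] r01.
  have /andP[r0 r1] := r01; have s0 : 0 <= 1 - r by lra.
  split; last exact: CE.
  split; rewrite /= ipDl !ipZl.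
    by have := ler_wpM2l r0 v1; have := ler_wpM2l s0 w1; lra.
  by have := ler_wpM2l r0 v2; have := ler_wpM2l s0 w2; lra.
(* The two claims are coupled: [S] inside [A k] makes [A k] nonempty, hence [x k.+1] a true
   projection lying in [C], and the projection inequality at [p] is membership of [p] in the next
   [cut_Q]. *)
have inv k : C (x k) /\ S `<=` cut_Q ip xg (x k).
  elim: k => [|k [Cx SQ]].
    by rewrite x0; split=> // p _; rewrite /cut_Q /= subrr ip0r.
  have SA : S `<=` A k.
    move=> p Sp; split; last by case: Sp => -[].
    split; last exact: SQ.
    by rewrite /cut_C /= !(distrC p); exact: up.
  have [] := A_proj k; first by have [p Sp] := S_nonempty; exists p; exact: SA.
  move=> [_ Cx'] hP; split=> // p Sp; rewrite /cut_Q /= ipC; exact/hP/SA.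
have Cx k : C (x k) := (inv k).1.
have Cy k : C (y k) := (yP k (Cx k)).1.
have Cz k : C (z k) := (zP k (Cx k)).1.
have Q_dist v k : cut_Q ip xg (x k) v ->
    `|v - x k| ^+ 2 <= `|v - xg| ^+ 2 - `|x k - xg| ^+ 2.
  rewrite /cut_Q /= => h.
  have -> : `|v - xg| ^+ 2 = `|v - x k| ^+ 2 + `|x k - xg| ^+ 2 - 2 * ip (v - x k) (xg - x k).
    rewrite -!ip_norm !ipE (ipC xg v) (ipC (x k) v) (ipC xg (x k)); ring.
  lra.
have [p0 Sp0] := S_nonempty.
have xA k : A k (x k.+1).
  have [] := A_proj k => //; exists p0; split; last by case: Sp0 => -[].
  split; last by have [_] := inv k; exact.
  by rewrite /cut_C /= !(distrC p0); exact: up.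
pose dist k := `|x k - xg| ^+ 2.
have dist_step k : `|x k.+1 - x k| ^+ 2 <= dist k.+1 - dist k.
  by apply: Q_dist; have [[]] := xA k.
have dist_le p k : S p -> dist k <= `|p - xg| ^+ 2.
  move=> Sp; rewrite -subr_ge0; apply: le_trans (Q_dist _ _ ((inv k).2 _ Sp)).
  exact: sqr_ge0.
have /cvg_ex[delta dist_cvg] : cvg (dist @ \oo).
  apply: nondecreasing_is_cvgn.
    apply/nondecreasing_seqP => k; rewrite -subr_ge0.
    by apply: le_trans (dist_step k); exact: sqr_ge0.
  by exists (`|p0 - xg| ^+ 2) => _ [k _ <-]; exact: dist_le.
have step0 : (fun k => x k.+1 - x k) @ \oo --> (0 : H).
  apply: (@cvg0_sqr_le R H (fun k => x k.+1 - x k) (fun k => dist k.+1 - dist k) dist_step).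
  rewrite -(subrr delta).
  by apply: cvgB => //; rewrite cvg_shiftS.
have xu0 : (fun k => 2 * `|x k.+1 - x k|) @ \oo --> (0 : R).
  rewrite -(mulr0 2); apply: cvgM; first exact: cvg_cst.
  by rewrite -(@normr0 _ H); exact: cvg_norm.
(* Membership of [x k.+1] in [cut_C] bounds its distance to [u k] by its distance to [x k]. *)
have xu k : `|u k - x k| <= 2 * `|x k.+1 - x k|.
  have [[xC _] _] := xA k; move: xC; rewrite /cut_C /= => xC.
  rewrite -(subrKA (x k.+1) (u k)) (le_trans (ler_normD _ _)) // distrC.
  by rewrite mulr_natl mulr2n lerD2r.
pose M := `|p0 - xg|.
have xM k : `|x k - xg| <= M.
  by rewrite /M -(@ler_pXn2r _ 2) ?nnegrE //; exact: (dist_le _ k Sp0).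
have xp0 k : `|x k - p0| <= 2 * M.
  rewrite -(subrKA xg (x k)) (le_trans (ler_normD _ _)) // (distrC xg).
  by rewrite mulr_natl mulr2n lerD2r.
(* The difference of squares factors: one factor is at most [|u k - x k|], the other is a sum of two
   distances to [p0], each at most [2 * M]. *)
have diff0 k : (1 - bet_hi) * ((1 - 2 * rho_hi * L1) * `|x k - y k| ^+ 2
      + (1 - 2 * rho_hi * L2) * `|y k - z k| ^+ 2)
    <= (2 * `|x k.+1 - x k|) * (4 * M).
  apply: (le_trans (uP k p0 (Cx k) Sp0)); rewrite subr_sqr.
  apply: ler_pM.
  - by rewrite subr_ge0; exact: up.
  - by rewrite addr_ge0.
  - apply: le_trans (xu k); rewrite (distrC (u k) (x k)) (le_trans (lerB_dist _ _)) //.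
    by rewrite opprB addrA subrK.
  - by have := up k p0 (Cx k) Sp0; have := xp0 k; lra.
have sqr0 (h : nat -> H) (e : R) : 0 < e ->
    (forall k, (1 - bet_hi) * (e * `|h k| ^+ 2) <= 2 * `|x k.+1 - x k| * (4 * M)) ->
    h @ \oo --> (0 : H).
  move=> e0 hh; have q0 : 0 < (1 - bet_hi) * e by exact: mulr_gt0.
  apply: (@cvg0_sqr_le R H h
    (fun k => 2 * `|x k.+1 - x k| * (4 * M / ((1 - bet_hi) * e)))) => [k|].
    rewrite mulrA ler_pdivlMr //; apply: le_trans (hh k).
    by rewrite [leLHS]mulrC -[leLHS]mulrA.
  rewrite -(mul0r (4 * M / ((1 - bet_hi) * e))); apply: cvgM => //; exact: cvg_cst.
have xy0 : (fun k => x k - y k) @ \oo --> (0 : H).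
  apply: (sqr0 _ _ e1) => k; apply: le_trans (diff0 k).
  by rewrite ler_pM2l // lerDl mulr_ge0 ?sqr_ge0 // ltW.
have yz0 : (fun k => y k - z k) @ \oo --> (0 : H).
  apply: (sqr0 _ _ e2) => k; apply: le_trans (diff0 k).
  by rewrite ler_pM2l // lerDr mulr_ge0 ?sqr_ge0 // ltW.
have Tx_x k : `|T (x k) - x k| <= 4 * M.
  rewrite -(subrKA p0 (T (x k))) (le_trans (ler_normD _ _)) // (distrC p0).
  by have := Ty _ _ (Cx k) Sp0; have := xp0 k; lra.
(* Solve the definition of [u k] for [T (z k) - x k]. The error [t k - x k = (1 - alph k) *: (T (x
   k) - x k)] vanishes because [alph] tends to 1, and division is by the fixed positive
   [1 - bet_hi]. *)
have Tz_x k : `|T (z k) - x k| <=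
    (2 * `|x k.+1 - x k| + (1 - alph k) * (4 * M)) / (1 - bet_hi).
  have /andP[b0 b1] := bet01 k; have /andP[_ bhi] := bet_bounds k.
  have al1 : 0 <= 1 - alph k by have /andP[_] := alph_bounds k; rewrite subr_ge0.
  rewrite ler_pdivlMr // mulrC.
  apply: (@le_trans _ _ (`|(1 - bet k) *: (T (z k) - x k)|)).
    by rewrite normrZ ler_wpM2r // ger0_norm ?subr_ge0 // lerD2l lerN2.
  have -> : (1 - bet k) *: (T (z k) - x k) =
      (u k - x k) - bet k *: ((1 - alph k) *: (T (x k) - x k)).
    have -> : (1 - alph k) *: (T (x k) - x k) = t k - x k.
      by rewrite t_def convrB subrr scaler0 add0r.
    by rewrite u_def convrB addrAC subrr add0r.
  apply: (le_trans (ler_normB _ _)); apply: lerD; first exact: xu.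
  rewrite !normrZ (ger0_norm b0) (ger0_norm al1) -[leRHS]mul1r.
  by apply: ler_pM => //; [rewrite mulr_ge0|rewrite ler_wpM2l].
have Tzx0 : (fun k => T (z k) - x k) @ \oo --> (0 : H).
  apply: (cvg0_le _ _ Tz_x).
  rewrite -[X in _ --> X](mul0r (1 - bet_hi)^-1); apply: cvgM; last exact: cvg_cst.
  rewrite -[X in _ --> X](addr0 0); apply: cvgD => //.
  rewrite -[X in _ --> X](mul0r (4 * M)); apply: cvgM; last exact: cvg_cst.
  by rewrite -(subrr 1); apply: cvgB => //; exact: cvg_cst.
have Tzz0 : (fun k => T (z k) - z k) @ \oo --> (0 : H).
  have -> : (fun k => T (z k) - z k) =
      (fun k => (T (z k) - x k) + ((x k - y k) + (y k - z k))).
    by apply/funext => k; rewrite !subrKA.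
  by rewrite -(addr0 0); apply: cvgD => //; rewrite -(addr0 0); apply: cvgD.
have xB k v : `|x k - v| <= M + `|xg - v|.
  by rewrite -(subrKA xg (x k)) (le_trans (ler_normD _ _)) // lerD2r.
have zB k : `|z k| <= 2 * M + `|p0|.
  rewrite -(subrK p0 (z k)) (le_trans (ler_normD _ _)) // lerD2r.
  apply: le_trans (xp0 k); rewrite -(@ler_pXn2r _ 2) ?nnegrE //.
  have := extragradient_ineq ip_norm A3 A4 (rho_gt0 k)
    (Cx k) (Cy k) (Cz k) Sp0.1 (yP k (Cx k)).2 (zP k (Cx k)).2.
  have /andP[_ r1] := rho_bounds k.
  have m1 : 0 <= (1 - 2 * rho k * L1) * `|x k - y k| ^+ 2.
    rewrite mulr_ge0 ?sqr_ge0 //.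
    have : rho k * L1 <= rho_hi * L1 by rewrite ler_pM2r.
    by move: rho_L1; clear; lra.
  have m2 : 0 <= (1 - 2 * rho k * L2) * `|y k - z k| ^+ 2.
    rewrite mulr_ge0 ?sqr_ge0 //.
    have : rho k * L2 <= rho_hi * L2 by rewrite ler_pM2r.
    by move: rho_L2; clear; lra.
  move: m1 m2; clear; lra.
have xB0 k : `|x k| <= M + `|xg| by have := xB k 0; rewrite !subr0.
have [l [s [sn xl]]] := weak_compactness ip_norm x _ xB0.
have Cl : C l.
  by apply: (weak_cvg_closed_convex ip_norm C (x \o s)) => // k; exact: Cx.
have xys0 : (fun n => y (s n) - x (s n)) @ \oo --> (0 : H).
  rewrite -oppr0; have -> : (fun n => y (s n) - x (s n)) =
      (fun n => - ((fun k => x k - y k) \o s) n).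
    by apply/funext => n /=; rewrite opprB.
  by apply: cvgN; exact: cvg_subseq.
have yl : weak_cvg ip (y \o s) l.
  have -> : y \o s = fun n => (x \o s) n + (y (s n) - x (s n)).
    by apply/funext => n /=; rewrite addrC subrK.
  exact: (weak_cvg_add ip_norm).
have zl : weak_cvg ip (z \o s) l.
  have -> : z \o s = fun n => (y \o s) n + (- ((fun k => y k - z k) \o s) n).
    by apply/funext => n /=; rewrite opprB addrC subrK.
  apply: (weak_cvg_add ip_norm) => //.
  by rewrite -oppr0; apply: cvgN; exact: cvg_subseq.
have Sl : S l.
  split; split=> //; last first.
    apply: (hybrid_demiclosed ip_norm A5 A5_sum A5_ab A5_d (z \o s) l _ _ _ _ zl) => //.
    - by move=> k; exact: Cz.
    - by move=> k; exact: zB.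
    - exact: (@cvg_subseq _ (fun k => T (z k) - z k)).
  move=> v Cv.
  (* Both arguments of [f (x (s n)) (y (s n))] tend weakly to [l], and [f l l = 0]. *)
  have h1 : (fun n => f (x (s n)) v - f (x (s n)) (y (s n))) @ \oo --> f l v.
    rewrite -[f l v]subr0 -(f_diag _ Cl); apply: cvgB.
      apply: (A1 l v (x \o s) (fun=> v)) => //.
      - by move=> k; exact: Cx.
      - by move=> w; exact: cvg_cst.
    apply: (A1 l l (x \o s) (y \o s)) => //.
    - by move=> k; exact: Cx.
    - by move=> k; exact: Cy.
  pose w n := ip (x (s n) - y (s n)) (v - x (s n)).
  have w0 : w @ \oo --> (0 : R).
    apply: (ip_cvg0 ip_norm _ _ (M + `|xg - v|)).
      exact: (@cvg_subseq _ (fun k => x k - y k)).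
    by move=> k; rewrite distrC; exact: xB.
  (* Since [rho] need not converge, [rho_lo] replaces it: the bracket is either nonnegative, or
     negative and then [rho (s n)] times it is at most [rho_lo] times it. Using [|w n|] covers both
     cases. *)
  have lim : (fun n => rho_lo * (f (x (s n)) v - f (x (s n)) (y (s n))) + `|w n|)
      @ \oo --> rho_lo * f l v + `|0 : R|.
    apply: cvgD; last exact: cvg_norm.
    by apply: cvgM => //; exact: cvg_cst.
  rewrite -(pmulr_rge0 _ rho_lo_gt0) -[leRHS]addr0 -[X in _ <= _ + X](@normr0 _ R).
  apply: (cvgr_to_ge lim); apply: nearW => n.
  have := (yP (s n) (Cx _)).2 v Cv.
  have -> : v - y (s n) = (v - x (s n)) + (x (s n) - y (s n)) by rewrite subrKA.
  rewrite ipDr -/(w n) ip_norm.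
  have := sqr_ge0 `|x (s n) - y (s n)|; have /andP[+ _] := rho_bounds (s n).
  have := normr_ge0 (w n); have := ler_norm (- w n); rewrite normrN.
  move: (rho (s n)) (f _ v - _) (`|_| ^+ 2) (w n) (`|w n|).
  move: rho_lo_gt0; clear; move=> lo0 r h q W aw aW aw0 lor q0 h2.
  have [h0|h0] := leP 0 h; first by rewrite addr_ge0 // mulr_ge0 // ltW.
  have := ler_wnM2r (ltW h0) lor; lra.
(* The weak limit [l] is itself a nearest point of [S], because every [x k] is at least as close to
   [xg] as any [p] in [S]; hence [xstar] is not the default value of [xget]. *)
have ex_min : exists q, S q /\ forall p, S p -> `|xg - q| <= `|xg - p|.
  exists l; split=> // p Sp; rewrite !(distrC xg).
  apply: (weak_cvg_norm_le ip_norm (x \o s)) => // k /=.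
  by rewrite -(@ler_pXn2r _ 2) ?nnegrE //; exact: dist_le.
have [Sx xmin] : S xstar /\ forall p, S p -> `|xg - xstar| <= `|xg - p|.
  exact: (xgetPex 0 ex_min).
have dist_delta k : dist k <= delta.
  rewrite -(cvg_lim _ dist_cvg) //; apply: nondecreasing_cvgn_le.
    by apply/nondecreasing_seqP => n; rewrite -subr_ge0 (le_trans _ (dist_step n)) ?sqr_ge0.
  by apply/cvg_ex; exists delta.
have delta0 : 0 <= delta by apply: le_trans (dist_delta 0%N); exact: sqr_ge0.
have l_delta : `|l - xg| ^+ 2 <= delta.
  rewrite -(sqr_sqrtr delta0) ler_pXn2r ?nnegrE ?sqrtr_ge0 //.
  apply: (weak_cvg_norm_le ip_norm (x \o s)) => // k /=.
  by rewrite -(@ler_pXn2r _ 2) ?nnegrE ?sqrtr_ge0 // sqr_sqrtr //; exact: dist_delta.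
have xstar_delta : `|xstar - xg| ^+ 2 <= delta.
  apply: le_trans l_delta; rewrite ler_pXn2r ?nnegrE // !(distrC _ xg); exact: xmin.
(* [Q_dist] at [xstar] bounds the squared distance by [delta - dist k]. *)
have xcvg0 : (fun k => xstar - x k) @ \oo --> (0 : H).
  apply: (@cvg0_sqr_le R H _ (fun k => delta - dist k)) => [k|].
    by apply: le_trans (Q_dist _ _ ((inv k).2 _ Sx)) _; rewrite lerD2r.
  by rewrite -(subrr delta); apply: cvgB => //; exact: cvg_cst.
have xcvg : x @ \oo --> xstar.
  have -> : x = fun k => xstar - (xstar - x k) by apply/funext => k; rewrite subKr.
  by rewrite -[X in _ --> X]subr0; apply: cvgB => //; exact: cvg_cst.
have ycvg : y @ \oo --> xstar.
  have -> : y = fun k => x k - (x k - y k) by apply/funext => k; rewrite subKr.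
  by rewrite -[X in _ --> X]subr0; apply: cvgB.
split=> //.
have -> : z = fun k => y k - (y k - z k) by apply/funext => k; rewrite subKr.
by rewrite -[X in _ --> X]subr0; apply: cvgB.
Qed.
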